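(* If $\mathfrak{B}\subseteq B(\mathcal{H})$ is a $\Sigma^*$-algebra and $\mathfrak{X}$ is a $\Sigma^*_{\mathfrak{B}}$-countably generated $\Sigma^*$-module over $\mathfrak{B}$, then $\mathfrak{X}\oplus C^w(\mathfrak{B})\cong C^w(\mathfrak{B})$ unitarily (i.e. via a surjective $\mathfrak{B}$-module map preserving the $\mathfrak{B}$-valued inner products).
   Context: WOT is the weak operator topology. A (concrete) $\Sigma^*$-algebra is a nondegenerate $C^*$-algebra $\mathfrak{B} \subseteq B(\mathcal{H})$ such that the limit in $B(\mathcal{H})$ of every WOT-convergent sequence in $\mathfrak{B}$ lies in $\mathfrak{B}$. A $C^*$-module over a $C^*$-algebra $A$ means a right Hilbert $C^*$-module, with $A$-valued inner product $\langle\cdot|\cdot\rangle$ linear and $A$-linear in the second variable and conjugate-linear in the first. $X\otimes_{\mathfrak{B}}\mathcal{H}$ is the Hilbert space completion of the algebraic module tensor product $X\odot_{\mathfrak{B}}\mathcal{H}$ for the inner product determined by $\langle x\otimes\zeta,y\otimes\eta\rangle=\langle\zeta,\langle x|y\rangle\eta\rangle$, and $X$ is canonically embedded in $B(\mathcal{H},X\otimes_{\mathfrak{B}}\mathcal{H})$ by $x(\zeta)=x\otimes\zeta$. A $C^*$-module $\mathfrak{X}$ over $\mathfrak{B}$ is a $\Sigma^*$-module if its canonical image in $B(\mathcal{H},\mathfrak{X}\otimes_{\mathfrak{B}}\mathcal{H})$ is WOT sequentially closed. For a sequence $(x_n)$ and $x$ in a $C^*$-module $X$ over $\mathfrak{B}$,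 $x_n\to x$ in WOT$_{\mathfrak{B}}$ means $\langle x_n|y\rangle\to\langle x|y\rangle$ WOT in $B(\mathcal{H})$ for all $y\in X$. $X$ is $\Sigma^*_{\mathfrak{B}}$-countably generated if there is a countable set $\{x_i\}_{i=1}^\infty\subseteq X$ such that the only subset of $X$ that contains $\{\sum_{i=1}^N x_ib_i : b_i\in\mathfrak{B},N\in\mathbb{N}\}$ and is closed under limits (in $X$) of WOT$_{\mathfrak{B}}$-convergent sequences is $X$ itself. $C^w(\mathfrak{B})$ is the $\Sigma^*$-module over $\mathfrak{B}$ of all sequences $(b_n)_{n\in\mathbb{N}}$ in $\mathfrak{B}$ such that $\sum_n b_n^*b_n$ is WOT-convergent in $\mathfrak{B}$, with coordinatewise right action and inner product $\langle(b_n)|(c_n)\rangle=\sum_n b_n^*c_n$ (WOT-convergent sum). $\oplus$ is the usual $C^*$-module direct sum of two modules. *)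

(* Defs.v *)
From HB Require Import structures.
From mathcomp Require Import all_boot all_order all_algebra.
From mathcomp Require Import all_classical all_reals all_analysis.
From mathcomp Require Import complex.

Set Implicit Arguments.
Unset Strict Implicit.
Unset Printing Implicit Defensive.

Import Order.TTheory GRing.Theory Num.Theory.
Import numFieldNormedType.Exports.

Local Open Scope classical_set_scope.
Local Open Scope ring_scope.
Local Open Scope complex_scope.

(* Complex Hilbert spaces; the inner product is linear in the second variable. *)
HB.mixin Record CompleteNormedModule_isHilbert (R : realType) H
    & CompleteNormedModule R[i] H := {
  hdot : H -> H -> R[i] ;
  hdotDr : forall x y z, hdot x (y + z) = hdot x y + hdot x z ;
  hdotZr : forall (a : R[i]) x y, hdot x (a *: y) = a * hdot x y ;
  hdotC : forall x y, hdot y x = (hdot x y)^* ;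
  hdotxx : forall x, hdot x x = `|x| ^+ 2 ;
}.

#[short(type="hilbertType")]
HB.structure Definition Hilbert (R : realType) :=
  {H of CompleteNormedModule R[i] H & CompleteNormedModule_isHilbert R H}.

Definition finite_sums (V : zmodType) (S : set V) : set V :=
  [set v | exists s : seq V, (forall u, u \in s -> S u) /\ v = \sum_(u <- s) u].

Section Operators.
Context {R : realType}.

(* B(H, K), as a set of functions *)
Definition bounded_op (H K : hilbertType R) : set (H -> K) :=
  [set a | linear a /\ continuous a].

(* Meant for bounded [a]: [sup] is 0 on unbounded sets. *)
Definition opnorm (H K : hilbertType R) (a : H -> K) : R :=
  sup [set complex.Re `|a x| | x in [set x : H | `|x| <= 1]].

Definition is_adjoint (H K : hilbertType R) (a : H -> K) (b : K -> H) : Prop :=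
  forall x y, hdot (a x) y = hdot x (b y).

Definition adjoint (H K : hilbertType R) (a : H -> K) : K -> H :=
  xget 0 [set b | is_adjoint a b].

Definition wot_cvg (H K : hilbertType R) (a_ : nat -> H -> K) (a : H -> K) :
    Prop :=
  forall x y,
    (fun n => hdot y (a_ n x) : R[i]^o) @ \oo --> (hdot y (a x) : R[i]^o).

Definition wot_lim (H K : hilbertType R) (a_ : nat -> H -> K) : H -> K :=
  xget 0 [set a | bounded_op a /\ wot_cvg a_ a].

Definition wot_seq_closed (H K : hilbertType R) (S : set (H -> K)) : Prop :=
  forall (a_ : nat -> H -> K) (a : H -> K),
    (forall n, S (a_ n)) -> bounded_op a -> wot_cvg a_ a -> S a.

Definition nondegenerate (H : hilbertType R) (B : set (H -> H)) : Prop :=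
  closure (finite_sums [set z | exists b x, B b /\ z = b x]) = setT.

Record concrete_cstar_algebra (H : hilbertType R) (B : set (H -> H)) : Prop := {
  csa_bounded : B `<=` @bounded_op H H ;
  csa0 : B 0 ;
  csaD : forall a b, B a -> B b -> B (a + b) ;
  csaZ : forall (l : R[i]) a, B a -> B (l *: a) ;
  csaM : forall a b, B a -> B b -> B (a \o b) ;
  csa_adjoint : forall a, B a -> exists2 b, B b & is_adjoint a b ;
  csa_closed : forall a, bounded_op a ->
    (forall e : R, 0 < e -> exists2 b, B b & opnorm (a - b) < e) -> B a
}.

Definition sigma_star_algebra (H : hilbertType R) (B : set (H -> H)) : Prop :=
  [/\ concrete_cstar_algebra B, nondegenerate B & wot_seq_closed B].

End Operators.

(* Right Hilbert C*-modules over B.  The value of [mact x b] is only relevant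
   for [b] in [B]. *)
Record cstar_module (R : realType) (H : hilbertType R) (B : set (H -> H)) := {
  mcar :> completeNormedModType R[i] ;
  mact : mcar -> (H -> H) -> mcar ;
  mip : mcar -> mcar -> (H -> H) ;
  mactDl : forall x y b, B b -> mact (x + y) b = mact x b + mact y b ;
  mactDr : forall x b c, B b -> B c -> mact x (b + c) = mact x b + mact x c ;
  mactZl : forall (l : R[i]) x b, B b -> mact (l *: x) b = l *: mact x b ;
  mactZr : forall (l : R[i]) x b, B b -> mact x (l *: b) = l *: mact x b ;
  mactA : forall x b c, B b -> B c -> mact x (b \o c) = mact (mact x b) c ;
  mip_in : forall x y, B (mip x y) ;
  mipDr : forall x y z, mip x (y + z) = mip x y + mip x z ;
  mipZr : forall (l : R[i]) x y, mip x (l *: y) = l *: mip x y ;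
  mip_act : forall x y b, B b -> mip x (mact y b) = mip x y \o b ;
  mip_adjoint : forall x y, is_adjoint (mip x y) (mip y x) ;
  mip_ge0 : forall x z, 0 <= hdot z (mip x x z) ;
  mip_norm : forall x, `|x| ^+ 2 = (opnorm (mip x x))%:C
}.

Section Modules.
Context {R : realType} {H : hilbertType R}.

(* [K], with [t x z] in the role of the elementary tensor [x (x) z], is the
   Hilbert space completion of the algebraic module tensor product of X and H
   over B; this determines (K, t) up to a unique unitary. *)
Record is_interior_tensor (B : set (H -> H)) (X : cstar_module B)
    (K : hilbertType R) (t : X -> H -> K) : Prop := {
  it_linearl : forall z, linear (t ^~ z) ;
  it_linearr : forall x, linear (t x) ;
  it_balanced : forall x b z, B b -> t (mact x b) z = t x (b z) ;
  it_dot : forall x y z w, hdot (t x z) (t y w) = hdot z (mip x y w) ;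
  it_dense : closure (finite_sums [set v | exists x z, v = t x z]) = setT
}.

Definition sigma_star_module (B : set (H -> H)) (X : cstar_module B) : Prop :=
  exists (K : hilbertType R) (t : X -> H -> K),
    is_interior_tensor t /\ wot_seq_closed (range t).

Definition wotB_cvg (B : set (H -> H)) (X : cstar_module B) (x_ : nat -> X)
    (x : X) : Prop :=
  forall y, wot_cvg (fun n => mip (x_ n) y) (mip x y).

Definition sigma_star_countably_generated (B : set (H -> H))
    (X : cstar_module B) : Prop :=
  exists g : nat -> X, forall S : set X,
    (forall (N : nat) (b : nat -> H -> H), (forall i, B (b i)) ->
       S (\sum_(i < N) mact (g i) (b i))) ->
    (forall (x_ : nat -> X) (x : X),
       (forall n, S (x_ n)) -> wotB_cvg x_ x -> S x) ->
    S = setT.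

(* The data of an inner product module whose elements are the members of a
   subset [iset] of a vector space; [iact] and [iip] are only relevant there. *)
Record ip_module := IPModule {
  icar : lmodType R[i] ;
  iset : set icar ;
  iact : icar -> (H -> H) -> icar ;
  iip : icar -> icar -> (H -> H)
}.

Definition ip_module_of (B : set (H -> H)) (X : cstar_module B) : ip_module :=
  {| icar := X ; iset := setT ; iact := @mact R H B X ; iip := @mip R H B X |}.

Definition ip_sum (M N : ip_module) : ip_module :=
  {| icar := (icar M * icar N)%type ;
     iset := @iset M `*` @iset N ;
     iact := fun x b => (iact x.1 b, iact x.2 b) ;
     iip := fun x y => iip x.1 y.1 + iip x.2 y.2 |}.

Definition Cw (B : set (H -> H)) : ip_module :=
  {| icar := nat -> H -> H ;
     iset := [set b : nat -> H -> H | (forall n, B (b n)) /\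
       exists2 a, B a & wot_cvg (fun N => \sum_(n < N) (adjoint (b n) \o b n)) a] ;
     iact := fun (b : nat -> H -> H) c n => b n \o c ;
     iip := fun b c : nat -> H -> H =>
       wot_lim (fun N => \sum_(n < N) (adjoint (b n) \o c n)) |}.

Definition unitarily_equivalent (B : set (H -> H)) (M N : ip_module) : Prop :=
  exists U : icar M -> icar N,
    [/\ forall x, iset x -> iset (U x),
        forall (l : R[i]) x y, iset x -> iset y ->
          U (l *: x + y) = l *: U x + U y,
        forall x b, iset x -> B b -> U (iact x b) = iact (U x) b,
        forall x y, iset x -> iset y -> iip (U x) (U y) = iip x y &
        forall y, iset y -> exists2 x, iset x & U x = y].

End Modules.

(* Main.v *)
From HB Require Import structures.
Require Import Defs.
From mathcomp Require Import all_boot all_order all_algebra.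
From mathcomp Require Import all_classical all_reals all_analysis.
From mathcomp Require Import complex ring lra.

Set Implicit Arguments.
Unset Strict Implicit.
Unset Printing Implicit Defensive.

Import Order.TTheory GRing.Theory Num.Theory.
Import numFieldNormedType.Exports.

Local Open Scope classical_set_scope.
Local Open Scope ring_scope.
Local Open Scope complex_scope.

(** The module [X] turns out to have a countable orthonormal basis, after which
the theorem is an Eilenberg swindle on coordinates.

Write [x z] for the vector [t x z] of the interior tensor product, so that the
elements of [X] act as operators from [H] to [K].

Polar decomposition.  Every [y] in [X] is [u <u|y>] for some [u] in [X] such
that [<u|u>] is a projection and [u <u|u> = u].  After scaling [y] to a
contraction [x], put [s = 1 - <x|x>] and let
[c_k] be the coefficients of [(1 - r)^(-1/2)].  The elements
[u_n = \sum_(k < n) c_k x s^k] belong to [X], because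
[x s^(k+1) = x s^k - (x s^k) <x|x>].  For a vector [z] the numbers
[D_k = <z, s^k z> - <z, s^(k+1) z>] are nonnegative with bounded telescoping
sums, and [<u_n z, u_m z>] is the sum of [c_i c_j D_(i+j)] over [i < n], [j < m].
As the Cauchy square of [(c_k)] is constantly [1], this sum is squeezed between
two partial sums of [D]; hence [u_n] converges strongly, and its limit is in
[X] because [X] is weakly sequentially closed ([polar_contraction], [polar]).

Orthonormal basis.  Gram-Schmidt with polar decomposition as the
normalization step, applied to the given generators, yields [u_i] with
[<u_i|u_j> = 0] for distinct [i], [j], with projections [p_i = <u_i|u_i>], and
such that only [0] is orthogonal to all of them: the elements orthogonal to a
fixed [y] form a set of the kind that occurs in the definition of countable
generation ([gram_schmidt]).  Bounded coordinate sequences can be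
summed ([riesz_fischer]), so that every [x] is the strong sum of the
[u_i <u_i|x>] ([parseval]): [X] is the direct sum of the [p_i B].

Swindle.  Index the coordinates of the column module by pairs [(i, j)] and split
the coordinate [(i, j)] into its parts in [p_i B] and [(1 - p_i) B].  For each
[i] there is then one copy of [p_i B] for every [j]; shift them by one place and
put the coordinate [<u_i|x>] of [X] in the place that becomes free:
  [U(x, b)_(i, 0) = (1 - p_i) b_(i, 0) + <u_i|x>],
  [U(x, b)_(i, j+1) = (1 - p_i) b_(i, j+1) + p_i b_(i, j)].
Vector by vector this preserves sums of squared norms ([sqsum_swindle]), hence
inner products by polarization ([sqdot_swindle]).

Weak convergence only has to be tested on real parts of inner products
([wot_cvgP]), so the analysis takes place in [H] as a real inner product
space, with real limits.  A sequence in [B] belongs to the column module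
exactly when its columns are square-summable with a sum bounded by a multiple
of the squared norm of the vector ([CwP]). *)

(** * Hilbert spaces as real inner product spaces *)

Section RealInnerProduct.
Context {R : realType} {H : hilbertType R}.
Implicit Types (x y z : H) (r : R) (v w : nat -> H).

Definition rdot x y : R := complex.Re (hdot x y).
Definition sq x : R := rdot x x.

Lemma rdotC x y : rdot x y = rdot y x.
Proof. by rewrite /rdot hdotC; case: (hdot y x). Qed.

Lemma rdotDr x y z : rdot x (y + z) = rdot x y + rdot x z.
Proof. by rewrite /rdot hdotDr; case: (hdot x y); case: (hdot x z). Qed.

Lemma rdotDl x y z : rdot (x + y) z = rdot x z + rdot y z.
Proof. by rewrite rdotC rdotDr !(rdotC z). Qed.

Lemma rdotZr r x y : rdot x (r%:C *: y) = r * rdot x y.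
Proof.
by rewrite /rdot hdotZr; case: (hdot x y) => a b; rewrite /= mul0r subr0.
Qed.

Lemma rdotZl r x y : rdot (r%:C *: x) y = r * rdot x y.
Proof. by rewrite rdotC rdotZr rdotC. Qed.

Lemma rdotNr x y : rdot x (- y) = - rdot x y.
Proof.
rewrite -scaleN1r (_ : -1 = (-1 : R)%:C); first by rewrite rdotZr mulN1r.
by rewrite rmorphN.
Qed.

Lemma rdotNl x y : rdot (- x) y = - rdot x y.
Proof. by rewrite rdotC rdotNr rdotC. Qed.

Lemma rdot0r x : rdot x 0 = 0.
Proof. by rewrite -[in LHS](subrr 0) rdotDr rdotNr subrr. Qed.

Lemma rdot0l x : rdot 0 x = 0.
Proof. by rewrite rdotC rdot0r. Qed.

Definition rdotE := (rdotDl, rdotDr, rdotNl, rdotNr, rdotZl, rdotZr).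

Lemma rdot_sumr (I : Type) (s : seq I) (P : pred I) x (F : I -> H) :
  rdot x (\sum_(i <- s | P i) F i) = \sum_(i <- s | P i) rdot x (F i).
Proof.
elim/big_rec2: _ => [|i a b _ <-]; [exact: rdot0r|exact: rdotDr].
Qed.

Lemma rdot_suml (I : Type) (s : seq I) (P : pred I) x (F : I -> H) :
  rdot (\sum_(i <- s | P i) F i) x = \sum_(i <- s | P i) rdot (F i) x.
Proof. by rewrite rdotC rdot_sumr; apply: eq_bigr => i _; rewrite rdotC. Qed.

Lemma Re_normK x : (complex.Re `|x|)%:C = `|x|.
Proof. by rewrite RRe_real // ger0_real. Qed.

Lemma Re_norm_ge0 x : 0 <= complex.Re `|x|.
Proof. by have := normr_ge0 x; rewrite lecE => /andP[_]. Qed.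

Lemma sqE x : sq x = complex.Re `|x| ^+ 2.
Proof. by rewrite /sq /rdot hdotxx -Re_normK -rmorphXn. Qed.

Lemma sq_ge0 x : 0 <= sq x.
Proof. by rewrite sqE sqr_ge0. Qed.

Lemma sq_eq0 x : sq x = 0 -> x = 0.
Proof.
rewrite sqE => /eqP; rewrite sqrf_eq0 => /eqP x0.
by apply/normr0_eq0; rewrite -Re_normK x0.
Qed.

Lemma rdot_eq0 x : (forall y, rdot y x = 0) -> x = 0.
Proof. by move=> h; exact/sq_eq0/h. Qed.

Lemma rdot_inj x y : (forall z, rdot z x = rdot z y) -> x = y.
Proof.
by move=> h; apply/subr0_eq/rdot_eq0 => z; rewrite !rdotE h subrr.
Qed.

Lemma Im_hdot x y : complex.Im (hdot x y) = rdot x (- 'i%C *: y).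
Proof. by rewrite /rdot hdotZr; case: (hdot x y) => a b /=; ring. Qed.

(** Young's inequality with a free weight; here it replaces Cauchy-Schwarz. *)
Lemma rdot_le x y (d : R) : 0 < d -> 2 * rdot x y <= d * sq x + d^-1 * sq y.
Proof.
move=> d0; have := sq_ge0 (d%:C *: x - y); rewrite /sq !rdotE (rdotC y x).
rewrite -(pmulr_rge0 _ (_ : 0 < d^-1)) ?invr_gt0 // => h.
rewrite -subr_ge0; apply: le_trans h _; rewrite le_eqVlt; apply/orP; left.
by apply/eqP; field; rewrite gt_eqF.
Qed.

Lemma normr_Re_lt (c : R[i]) (e : R) : `|c| < e%:C -> `|complex.Re c| < e.
Proof.
rewrite -ltcR; apply: le_lt_trans; case: c => a b /=; rewrite normc_def /= lecR.
by rewrite -sqrtr_sqr ler_wsqrtr // lerDl sqr_ge0.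
Qed.

Lemma normr_Im_lt (c : R[i]) (e : R) : `|c| < e%:C -> `|complex.Im c| < e.
Proof.
rewrite -ltcR; apply: le_lt_trans; case: c => a b /=; rewrite normc_def /= lecR.
by rewrite -sqrtr_sqr ler_wsqrtr // lerDr sqr_ge0.
Qed.

Lemma normc_lt (c : R[i]) (e : R) :
  `|complex.Re c| < e / 2 -> `|complex.Im c| < e / 2 -> `|c| < e%:C.
Proof.
case: c => a b /= ha hb; rewrite normc_def /= ltcR.
have u0 := normr_ge0 a; have w0 := normr_ge0 b.
have e0 : 0 < e by lra.
rewrite -[e]gtr0_norm // -sqrtr_sqr ltr_sqrt ?exprn_gt0 //.
rewrite -(real_normK (num_real a)) -(real_normK (num_real b)).
by nra.
Qed.

Lemma cvg_complexP (f : nat -> R[i]) (l : R[i]) :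
  ((f : nat -> R[i]^o) @ \oo --> (l : R[i]^o)) <->
  ((fun n => complex.Re (f n)) @ \oo --> complex.Re l) /\
  ((fun n => complex.Im (f n)) @ \oo --> complex.Im l).
Proof.
split=> [/cvgrPdist_lt h|[/cvgrPdist_lt hr /cvgrPdist_lt hi]].
  split; apply/cvgrPdist_lt => e e0; have := h e%:C; rewrite ltcR => /(_ e0);
    apply: filterS => n; [move=> /normr_Re_lt|move=> /normr_Im_lt];
    by case: l (f n) {h} => a b [c d].
apply/cvgrPdist_lt => -[e e']; rewrite ltcE /= => /andP[/eqP -> e0].
have e2 : 0 < e / 2 by rewrite divr_gt0.
have := hr _ e2; have := hi _ e2; apply: filterS2 => n h1 h2.
by apply: normc_lt; case: l (f n) h1 h2 {hr hi} => a b [c d].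
Qed.

(** Norm convergence, phrased with the real-valued squared norm. *)
Definition tends v x := (fun n => sq (v n - x)) @ \oo --> (0 : R).

(** Completeness, with the Cauchy condition on squared distances. *)
Lemma sq_cauchy_tends v :
  (forall e : R, 0 < e -> exists N, forall m n, (N <= m)%N -> (N <= n)%N ->
    sq (v m - v n) <= e) -> exists x, tends v x.
Proof.
move=> h; have : cvg (v @ \oo).
  apply/cauchy_cvgP/cauchyP => -[e e']; rewrite ltcE /= => /andP[/eqP -> e0].
  have [|N hN] := h ((e / 2) ^+ 2); first by rewrite exprn_gt0 // divr_gt0.
  exists (v N); exists N => // n /= Nn; rewrite -ball_normE /= -Re_normK ltcR.
  apply: (@le_lt_trans _ _ (e / 2)); last by rewrite ltr_pdivrMr // ltr_pMr // ltr1n.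
  have := hN N n (leqnn N) Nn; rewrite sqE ler_sqr ?nnegrE ?Re_norm_ge0 //.
  by rewrite divr_ge0 // ltW.
move=> /cvgrPdist_lt hv; exists (lim (v @ \oo)); apply/cvgrPdist_lt => e e0.
have := hv (Num.sqrt e)%:C; rewrite ltcR sqrtr_gt0 => /(_ e0).
apply: filterS => n; rewrite -Re_normK ltcR => hn.
rewrite sub0r normrN ger0_norm ?sq_ge0 // sqE -[e]sqr_sqrtr 1?ltW //.
by rewrite ltr_sqr ?nnegrE ?sqrtr_ge0 ?Re_norm_ge0 // distrC.
Qed.

Lemma tends_rdot v x y : tends v x -> (fun n => rdot y (v n)) @ \oo --> rdot y x.
Proof.
move=> h; apply/cvgrPdist_le => e e0.
have d0 : 0 < e / (1 + sq y) by rewrite divr_gt0 // ltr_wpDr // sq_ge0.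
set d := e / (1 + sq y) in d0.
have : 0 < e * d by rewrite mulr_gt0.
move: h => /cvgrPdist_le h /h; apply: filterS => n.
rewrite sub0r normrN ger0_norm ?sq_ge0 // => hn.
have key (z : H) : sq z <= e * d -> rdot y z <= e.
  move=> hz; have := rdot_le y z d0.
  have h1 : d^-1 * sq z <= e by rewrite mulrC ler_pdivrMr.
  have h2 : d * sq y <= e.
    rewrite /d mulrAC ler_pdivrMr ?ler_pM2l // ?lerDr //.
    by rewrite ltr_wpDr // sq_ge0.
  by lra.
have e1 : rdot y x - rdot y (v n) = rdot y (x - v n) by rewrite !rdotE.
have sN (z : H) : sq (- z) = sq z by rewrite /sq !rdotE opprK.
rewrite e1 ler_norml; apply/andP; split; last first.
  by apply: key; rewrite -sN opprB.
by rewrite lerNl -rdotNr; apply: key; rewrite opprB.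
Qed.

Lemma tends_sq v x : tends v x -> (fun n => sq (v n)) @ \oo --> sq x.
Proof.
move=> h.
have -> : (fun n => sq (v n)) =
  (fun n => sq (v n - x) + 2 * rdot x (v n) - sq x).
  by apply/funext => n; rewrite /sq !rdotE (rdotC x); ring.
have {2}-> : sq x = 0 + 2 * rdot x x - sq x by rewrite /sq; ring.
apply: cvgB; last exact: cvg_cst.
by apply: cvgD => //; apply: cvgMr; exact: tends_rdot.
Qed.

(** Weak limits suffice to identify a vector. *)
Lemma weak_limit_unique v x y :
  (forall z, (fun n => rdot z (v n)) @ \oo --> rdot z x) ->
  (forall z, (fun n => rdot z (v n)) @ \oo --> rdot z y) -> x = y.
Proof.
by move=> hx hy; apply: rdot_inj => z; apply: cvg_unique (hx z) (hy z).
Qed.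

End RealInnerProduct.

(** Imaginary parts come for free: [Im <y, v>] is the real part of the inner
product of [v] with a rotated [y]. *)
Lemma wot_cvgP (R : realType) (H K : hilbertType R) (a_ : nat -> H -> K)
    (a : H -> K) :
  wot_cvg a_ a <->
  forall x y, (fun n => rdot y (a_ n x)) @ \oo --> rdot y (a x).
Proof.
split=> [h x y|h x y]; first by case/cvg_complexP: (h x y).
apply/cvg_complexP; split; first exact: h.
rewrite Im_hdot; under eq_fun do rewrite Im_hdot.
have e z : rdot y (- 'i%C *: z) = rdot ('i%C *: y) z.
  rewrite /rdot hdotZr [hdot (_ *: y) z]hdotC hdotZr [hdot y z]hdotC.
  by case: (hdot z y) => c d /=; ring.
by rewrite e; under eq_fun do rewrite e; exact: h.
Qed.

(** * Bounded operators and their strong limits *)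

Section BoundedOperators.
Context {R : realType} {H K : hilbertType R}.

Lemma bounded_op_le (a : H -> K) :
  bounded_op a -> exists2 C : R, 0 < C & forall z, sq (a z) <= C * sq z.
Proof.
case=> la ca.
pose la' := GRing.isLinear.Build _ _ _ _ a la.
pose f : {linear H -> K} := HB.pack a la'.
have /linear_boundedP : bounded_near f (nbhs (0 : H)).
  by apply: continuous_linear_bounded; exact: ca.
case=> M [Mr hM].
have M1 : M < (`|complex.Re M| + 1)%:C.
  case: M Mr {hM} => m m'; rewrite complex_real => /eqP /= ->.
  by rewrite ltcR (le_lt_trans (ler_norm _)) // ltrDl.
set C := `|complex.Re M| + 1 in M1.
have C0 : 0 < C by rewrite ltr_wpDl.
exists (C ^+ 2); first by rewrite exprn_gt0.
move=> z; have := hM _ M1 z; rewrite -(Re_normK z) -(Re_normK (f z)) -rmorphM lecR => h.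
by rewrite !sqE -exprMn ler_sqr ?nnegrE ?mulr_ge0 ?Re_norm_ge0 // ltW.
Qed.

Lemma bounded_op_of_le (a : H -> K) (C : R) :
  linear a -> (forall z, sq (a z) <= C * sq z) -> bounded_op a.
Proof.
move=> la hC; split=> //.
pose la' := GRing.isLinear.Build _ _ _ _ a la.
pose f : {linear H -> K} := HB.pack a la'.
change (continuous f); apply/linear_bounded_continuous/linear_boundedP.
pose D := Num.sqrt `|C|.
exists D%:C; split; first by rewrite realE ler0c sqrtr_ge0.
move=> [r r']; rewrite ltcE /= => /andP[/eqP -> Dr] x.
rewrite -[r +i* 0]/(r%:C) -(Re_normK x) -(Re_normK (f x)) -rmorphM lecR.
apply: (@le_trans _ _ (D * complex.Re `|x|)).
  rewrite -ler_sqr ?nnegrE ?mulr_ge0 ?Re_norm_ge0 ?sqrtr_ge0 //.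
  rewrite exprMn -!sqE sqr_sqrtr //; apply: le_trans (hC x) _.
  by rewrite ler_wpM2r ?sq_ge0 // ler_norm.
by rewrite ler_wpM2r ?Re_norm_ge0 // ltW.
Qed.

Lemma wot_cvg_tends (a_ : nat -> H -> K) (a : H -> K) :
  (forall z, tends (a_^~ z) (a z)) -> wot_cvg a_ a.
Proof. by move=> h; apply/wot_cvgP => x y; exact: tends_rdot. Qed.

(** Linearity passes to weak limits, and so does the uniform bound. *)
Lemma tends_bounded_op (a_ : nat -> H -> K) (C : R) :
  (forall n, linear (a_ n)) -> (forall n z, sq (a_ n z) <= C * sq z) ->
  (forall z, exists x, tends (a_^~ z) x) ->
  exists2 a, bounded_op a & forall z, tends (a_^~ z) (a z).
Proof.
move=> la hC ha.
have [a aE] : exists a : H -> K, forall z, tends (a_^~ z) (a z).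
  by exists (fun z => projT1 (cid (ha z))) => z; case: (cid (ha z)).
exists a => //; apply: (@bounded_op_of_le _ C).
  move=> l x y.
  apply: (@weak_limit_unique _ _ (fun n => a_ n (l *: x + y))) => z; first exact: tends_rdot.
  have -> : (fun n => rdot z (a_ n (l *: x + y))) =
     (fun n => rdot z (l *: a_ n x) + rdot z (a_ n y)).
    by apply/funext => n; rewrite la rdotDr.
  rewrite rdotDr; apply: cvgD; last exact: tends_rdot.
  (* a complex scalar moves to the other side as its conjugate *)
  have [w hw] : exists w, forall v : K, rdot z (l *: v) = rdot w v.
    exists (l^* *: z) => v; rewrite /rdot hdotZr [hdot (_ *: _) _]hdotC hdotZr.
    by rewrite [hdot z v]hdotC; case: l (hdot v z) => a1 a2 [b1 b2] /=; ring.
  by rewrite hw; under eq_fun do rewrite hw; exact: tends_rdot.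
move=> z; have /tends_sq h := aE z; rewrite -subr_ge0.
have h' : (fun n => C * sq z - sq (a_ n z)) @ \oo --> C * sq z - sq (a z).
  by apply: cvgB => //; exact: cvg_cst.
rewrite -(cvg_lim _ h') //; apply: limr_ge; first by apply/cvg_ex; eexists; exact: h'.
by apply: nearW => n; rewrite subr_ge0.
Qed.

End BoundedOperators.

(** * Binomial coefficients of the inverse square root *)

Section InverseSqrt.
Context {R : realFieldType}.

(** Taylor coefficients of [(1 - r)^(-1/2)], that is ['C(2k, k) / 4^k]. *)
Fixpoint invsqrt_coef (k : nat) : R :=
  if k is k'.+1 then invsqrt_coef k' * (k'.*2.+1%:R / k'.*2.+2%:R) else 1.
Local Notation c := invsqrt_coef.

Lemma invsqrt_coef_ge0 k : 0 <= c k.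
Proof. by elim: k => //= k ih; rewrite mulr_ge0 // divr_ge0. Qed.

Lemma invsqrt_coef_rec k : k.+1%:R * c k.+1 = (k%:R + 2^-1) * c k.
Proof.
rewrite /=.
have k0 : 1 + k%:R != 0 :> R by rewrite addrC natr1 pnatr_eq0.
have -> : k.*2.+2%:R = 2 * (1 + k%:R) :> R.
  by rewrite -doubleS -muln2 natrM -natr1; ring.
have -> : k.*2.+1%:R = 2 * k%:R + 1 :> R by rewrite -natr1 -muln2 natrM; ring.
by rewrite -natr1; field; rewrite addrC.
Qed.

Lemma sum_conv_sym (F : nat -> R) n :
  \sum_(i < n.+1) (n - i)%N%:R * (F i * F (n - i)%N) =
  \sum_(i < n.+1) i%:R * (F i * F (n - i)%N).
Proof.
rewrite (reindex_inj rev_ord_inj) /=; apply: eq_bigr => i _.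
by rewrite subSS subKn ?leq_ord // (mulrC (F i)).
Qed.

(** The square of [(1 - r)^(-1/2)] is the geometric series.  By
[invsqrt_coef_rec] and the symmetry of the convolution square [S_n], both
[(n + 1) S_(n+1)] and [(n + 1) S_n] equal twice the sum of
[(i + 1/2) c_i c_(n-i)]. *)
Lemma invsqrt_coef_conv n : \sum_(i < n.+1) c i * c (n - i)%N = 1.
Proof.
elim: n => [|n ih]; first by rewrite big_ord1 mulr1.
set S := LHS.
suff : n.+1%:R * S = n.+1%:R * 1.
  by apply: mulfI; rewrite pnatr_eq0.
have e1 : n.+1%:R * S = 2 * \sum_(i < n.+2) i%:R * (c i * c (n.+1 - i)%N).
  rewrite mulr2n mulrDl !mul1r -{1}sum_conv_sym -big_split /= mulr_sumr.
  by apply: eq_bigr => i _; rewrite -mulrDl -natrD subnK // leq_ord.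
rewrite e1 big_ord_recl mul0r add0r.
have -> : \sum_(i < n.+1) (bump 0 i)%:R * (c (bump 0 i) * c (n.+1 - bump 0 i)%N)
  = \sum_(i < n.+1) (i%:R + 2^-1) * (c i * c (n - i)%N).
  apply: eq_bigr => i _; rewrite /bump leq0n add1n subSS [LHS]mulrA invsqrt_coef_rec.
  by rewrite mulrA.
have -> : 2 * \sum_(i < n.+1) (i%:R + 2^-1) * (c i * c (n - i)%N) =
  \sum_(i < n.+1) n.+1%:R * (c i * c (n - i)%N).
  under eq_bigr do rewrite mulrDl.
  rewrite big_split /= mulrDr -mulr_sumr mulrA divff ?pnatr_eq0 // mul1r.
  rewrite mulr2n mulrDl !mul1r -{1}sum_conv_sym -!big_split /=.
  apply: eq_bigr => i _.
  have -> : n.+1%:R = (n - i)%N%:R + i%:R + 1 :> R.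
    by rewrite -natrD subnK ?leq_ord // natr1.
  by ring.
by rewrite -mulr_sumr ih.
Qed.

(** The square [i < n], [j < m] lies in the triangle [i + j < n + m], and along
each diagonal of the triangle the coefficients add up to [1]. *)
Lemma invsqrt_square_le (d : nat -> R) n m : (forall k, 0 <= d k) ->
  \sum_(i < n) \sum_(j < m) c i * c j * d (i + j)%N <= \sum_(k < n + m) d k.
Proof.
move=> d0.
have -> : \sum_(i < n) \sum_(j < m) c i * c j * d (i + j)%N =
  \sum_(k < n + m) \sum_(i < n) \sum_(j < m | (i + j == k)%N) c i * c j * d k.
  rewrite [RHS]exchange_big /=; apply: eq_bigr => i _.
  rewrite [RHS](exchange_big_dep xpredT) //=; apply: eq_bigr => j _.
  have ij : (i + j < n + m)%N by rewrite -addSn leq_add // ltnW.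
  by rewrite (big_pred1 (Ordinal ij)).
apply: ler_sum => k _.
have -> : \sum_(i < n) \sum_(j < m | (i + j == k)%N) c i * c j * d k =
   d k * \sum_(i < n | (i <= k)%N && (k - i < m)%N) c i * c (k - i)%N.
  rewrite mulr_sumr [RHS]big_mkcond /=; apply: eq_bigr => i _.
  case: ifPn => [/andP[ik km]|].
    rewrite (big_pred1 (Ordinal km)) /= => [|j]; first by rewrite mulrC.
    by rewrite /= -val_eqE /= -[RHS](eqn_add2l i) subnKC.
  move=> hk; rewrite big_pred0 // => j; apply: contraNF hk => /eqP <-.
  by rewrite leq_addr addKn /=.
rewrite -[leRHS]mulr1 ler_wpM2l // -(invsqrt_coef_conv k).
have s0 (i : nat) : 0 <= c i * c (k - i)%N by rewrite mulr_ge0 ?invsqrt_coef_ge0.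
rewrite -(big_mkord (fun i => (i <= k)%N && (k - i < m)%N) (fun i => c i * c (k - i)%N)).
rewrite -(big_mkord xpredT (fun i => c i * c (k - i)%N)).
rewrite big_mkcond [leRHS]big_mkcond /=.
have [nk|kn] := leqP n k.+1.
  rewrite [leRHS](@big_cat_nat _ _ _ n) //= -[leLHS]addr0 lerD //.
    apply: ler_sum => i _; by case: ifP.
  by apply: sumr_ge0 => i _.
rewrite (@big_cat_nat _ _ _ k.+1) //= 1?ltnW // -[leRHS]addr0 lerD //.
  by apply: ler_sum => i _; case: ifP.
rewrite big_nat_cond big1 // => i /andP[/andP[ki _] _].
by rewrite leqNgt ki.
Qed.

(** Dually, the square contains the triangle [i + j < N]. *)
Lemma invsqrt_square_ge (d : nat -> R) N n m : (forall k, 0 <= d k) ->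
  (N <= n)%N -> (N <= m)%N ->
  \sum_(k < N) d k <= \sum_(i < n) \sum_(j < m) c i * c j * d (i + j)%N.
Proof.
move=> d0 Nn Nm.
have s0 i j : 0 <= c i * c j * d (i + j)%N by rewrite !mulr_ge0 ?invsqrt_coef_ge0.
have tri : \sum_(k < N) d k =
  \sum_(i < N) \sum_(j < N | (i + j < N)%N) c i * c j * d (i + j)%N.
  have -> : \sum_(i < N) \sum_(j < N | (i + j < N)%N) c i * c j * d (i + j)%N =
    \sum_(i < N) \sum_(j < N) \sum_(k < N | (i + j == k)%N) c i * c j * d k.
    apply: eq_bigr => i _; rewrite big_mkcond; apply: eq_bigr => j _.
    case: ifPn => ij.
      rewrite (big_pred1 (Ordinal ij)) // => k; by rewrite /= -val_eqE /= eq_sym.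
    rewrite big_pred0 // => k; apply: contraNF ij => /eqP ->; exact: ltn_ord.
  under [RHS]eq_bigr do rewrite (exchange_big_dep xpredT) //=.
  rewrite exchange_big /=; apply: eq_bigr => k _.
  rewrite -[LHS]mulr1 -(invsqrt_coef_conv k) mulr_sumr.
  rewrite (big_ord_widen_cond N xpredT (fun i => d k * (c i * c (k - i)%N))) //=.
  rewrite big_mkcond; apply: eq_bigr => i _; case: ifPn => ik.
    have kN : (k - i < N)%N by rewrite (leq_ltn_trans (leq_subr _ _)).
    rewrite (big_pred1 (Ordinal kN)) /= => [|j]; first by rewrite mulrC.
    by rewrite /= -val_eqE /= -[RHS](eqn_add2l i) subnKC.
  rewrite big_pred0 // => j; apply: contraNF ik => /eqP <-.
  by rewrite ltnS leq_addr.
rewrite tri.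
rewrite (big_ord_widen n (fun i => \sum_(j < N | (i + j < N)%N) c i * c j * d (i + j)%N)) //.
rewrite big_mkcond; apply: ler_sum => i _; case: ifP => _; last first.
  by apply: sumr_ge0 => j _.
rewrite (big_ord_widen_cond m (fun j => (i + j < N)%N) (fun j => c i * c j * d (i + j)%N)) //.
by rewrite big_mkcond; apply: ler_sum => j _; case: ifP.
Qed.

End InverseSqrt.

(** * Powers of a positive contraction *)

Section Linear.
Context {R : realType} {V W : lmodType R[i]} {f : V -> W}.
Hypothesis lf : linear f.

Lemma lin0 : f 0 = 0.
Proof. by have := lf (-1) 0 0; rewrite !scaleN1r oppr0 add0r addNr. Qed.
Lemma linD x y : f (x + y) = f x + f y.
Proof. by have := lf 1 x y; rewrite !scale1r. Qed.
Lemma linZ l x : f (l *: x) = l *: f x.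
Proof. by have := lf l x 0; rewrite !addr0 lin0 addr0. Qed.
Lemma linN x : f (- x) = - f x.
Proof. by rewrite -scaleN1r linZ scaleN1r. Qed.
Lemma linB x y : f (x - y) = f x - f y.
Proof. by rewrite linD linN. Qed.
Lemma lin_sum (I : Type) (r : seq I) (P : pred I) (F : I -> V) :
  f (\sum_(i <- r | P i) F i) = \sum_(i <- r | P i) f (F i).
Proof. by elim/big_rec2: _ => [|i a b _ <-]; rewrite ?lin0 ?linD. Qed.
End Linear.

Lemma nonincreasing_ge0_lim (R : realType) (m : nat -> R) :
  (forall k, 0 <= m k) -> (forall k, m k.+1 <= m k) ->
  exists l, [/\ m @ \oo --> l, forall k, l <= m k &
    forall e, 0 < e -> exists N, m N <= l + e].
Proof.
move=> m0 m1; have ni : nonincreasing_seq m by exact/nonincreasing_seqP.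
have c : cvgn m by apply: nonincreasing_is_cvgn => //; exists 0 => _ [k _ <-].
exists (lim (m @ \oo)); split=> //.
  by move=> k; exact: nonincreasing_cvgn_ge.
move=> e e0; have /cvgrPdist_le /(_ e e0) [N _ hN] := c.
by exists N; have := hN N (leqnn N); rewrite ler_norml => /andP[]; lra.
Qed.

Section PositiveContraction.
Context {R : realType} {H : hilbertType R} (s : H -> H).
Hypothesis ls : linear s.
Hypothesis s_sym : forall z w, rdot (s z) w = rdot z (s w).
Hypothesis s_ge0 : forall z, 0 <= rdot z (s z).
Hypothesis s_le1 : forall z, rdot z (s z) <= sq z.

Definition moment (z : H) k : R := rdot z (iter k s z).

Lemma iter_sym k z w : rdot (iter k s z) w = rdot z (iter k s w).
Proof. by elim: k w => //= k ih w; rewrite s_sym ih -iterSr. Qed.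

Lemma rdot_iter z j k : rdot (iter j s z) (iter k s z) = moment z (j + k).
Proof. by rewrite iter_sym -iterD. Qed.

Lemma moment_ge0 z k : 0 <= moment z k.
Proof.
rewrite -(odd_double_half k) -addnn addnCA -rdot_iter.
by case: (odd k); [exact: s_ge0|exact: sq_ge0].
Qed.

(** For odd [k] this is [s - s^2 >= 0] at a vector [v], which follows from
[s - s^2 = s (1 - s) s + (1 - s) s (1 - s)]. *)
Lemma moment_decr z k : moment z k.+1 <= moment z k.
Proof.
rewrite -(odd_double_half k) -addnn addnCA -addnS -!rdot_iter.
set v := iter _ s z; case: (odd k); rewrite /= ?add1n ?add0n /=; last exact: s_le1.
have h1 := s_ge0 (v - s v); have h2 := s_le1 (s v).
have e : rdot v (s (s v)) = sq (s v) by rewrite -s_sym.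
move: h1; rewrite (linB ls) !rdotE e -/(sq (s v)).
by move: h2; rewrite -/v; lra.
Qed.

(** The limit [q] is the projection onto the fixed vectors of [s].  The squared
distance of two powers at [z] is a combination of three moments, all
close to the limit of the moments. *)
Lemma powers_tend : exists q : H -> H, [/\ linear q,
  forall z, tends (fun k => iter k s z) (q z) & forall z, q (q z) = q z].
Proof.
have lim1 z : exists x, tends (fun k => iter k s z) x.
  apply: sq_cauchy_tends => e e0.
  have [l [_ hl hN]] := nonincreasing_ge0_lim (moment_ge0 z) (moment_decr z).
  have [|N lN] := hN (e / 2); first by rewrite divr_gt0.
  have dec k : (N <= k)%N -> moment z k <= moment z N.
    by move: N k {hN lN}; apply/nonincreasing_seqP/moment_decr.
  exists N => m n Nm Nn; rewrite /sq !rdotE !rdot_iter (addnC n m).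
  have h1 := hl (m + n)%N.
  have h2 := dec (m + m)%N (leq_trans Nm (leq_addr _ _)).
  have h3 := dec (n + n)%N (leq_trans Nn (leq_addr _ _)).
  by lra.
have l_iter k : linear (iter k s).
  by elim: k => [|k ih] l x y //=; rewrite ih (linD ls) (linZ ls).
have le_iter k z : sq (iter k s z) <= 1 * sq z.
  rewrite /sq rdot_iter mul1r -/(moment z 0).
  have /nonincreasing_seqP := moment_decr z; exact.
have [q [lq _] hq] := tends_bounded_op l_iter le_iter lim1.
have sqq z : s (q z) = q z.
  apply: (@weak_limit_unique _ _ (fun k => iter k.+1 s z)) => y.
    have e k : rdot y (iter k.+1 s z) = rdot (s y) (iter k s z) by rewrite /= s_sym.
    rewrite -s_sym; under eq_fun do rewrite e.
    by apply: tends_rdot (hq z).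
  have := tends_rdot (y := y) (hq z).
  by rewrite -(cvg_shiftS (fun k => rdot y (iter k s z))).
exists q; split=> // z.
have e k : iter k s (q z) = q z by elim: k => //= k ->.
apply: (@weak_limit_unique _ _ (fun k => iter k s (q z))) => y.
  exact: tends_rdot.
by under eq_fun do rewrite e; exact: cvg_cst.
Qed.

End PositiveContraction.

(** * Polar decomposition in the module *)

Section InteriorTensor.
Context {R : realType} {H : hilbertType R} {B : set (H -> H)} (X : cstar_module B).
Context (K : hilbertType R) (t : X -> H -> K).
Hypothesis algB : concrete_cstar_algebra B.
Hypothesis tensor : is_interior_tensor t.
Hypothesis closed_t : wot_seq_closed (range t).

Lemma mip_linear (x y : X) : linear (mip x y).
Proof. by case: (csa_bounded algB (mip_in x y)). Qed.

Let t_linear := it_linearr tensor.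
Let t_linearl := it_linearl tensor.

Lemma rdot_tensor x y z w : rdot (t x z) (t y w) = rdot z (mip x y w).
Proof. by rewrite /rdot (it_dot tensor). Qed.

(** The norm of [x] is determined by [<x|x>], hence by the operator [t x]. *)
Lemma tensor_eq0 x : (forall z, t x z = 0) -> x = 0.
Proof.
move=> x0; have m0 : mip x x = 0.
  by apply/funext => w; apply: rdot_eq0 => z; rewrite -rdot_tensor x0 rdot0l.
apply/normr0_eq0/eqP; rewrite -sqrf_eq0 mip_norm m0 /opnorm.
rewrite (_ : [set _ | _ in _] = [set 0]) ?sup1 //.
apply/seteqP; split=> [_ [w _ <-]|_ ->]; first by rewrite normr0.
by exists 0; rewrite /= ?normr0.
Qed.

Lemma tensor_le x : exists2 C : R, 0 < C & forall z, sq (t x z) <= C * sq z.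
Proof.
have [C C0 hC] := bounded_op_le (csa_bounded algB (mip_in x x)).
exists (1 + C); first by rewrite addr_gt0.
move=> z; rewrite {1}/sq rdot_tensor.
have := rdot_le z (mip x x z) ltr01; have := hC z; rewrite invr1 !mul1r.
by have := sq_ge0 z; have := sq_ge0 (mip x x z); nra.
Qed.

(** Weak sequential closedness of the module, in the form in which it is
used. *)
Lemma module_limit (x_ : nat -> X) (C : R) :
  (forall n z, sq (t (x_ n) z) <= C * sq z) ->
  (forall z, exists y, tends (fun n => t (x_ n) z) y) ->
  exists x, forall z, tends (fun n => t (x_ n) z) (t x z).
Proof.
move=> hC ht.
have [a ba ha] := tends_bounded_op (fun n => t_linear (x_ n)) hC ht.
have [|x _ xa] := closed_t _ ba (wot_cvg_tends ha).
  by move=> n; exists (x_ n).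
by exists x => z; rewrite xa.
Qed.

Section PolarContraction.
Variable x : X.
Hypothesis x_le1 : forall z, sq (t x z) <= sq z.

Let s z := z - mip x x z.
Local Notation c := (@invsqrt_coef R).

Let s_linear : linear s.
Proof.
move=> l z w; rewrite /s mip_linear scalerBr opprD addrACA.
by [].
Qed.

Let s_sym z w : rdot (s z) w = rdot z (s w).
Proof. by rewrite /s !rdotE (rdotC (mip x x z)) -!rdot_tensor (rdotC (t x w)). Qed.

Let rdot_s z w : rdot z (s w) = rdot z w - rdot (t x z) (t x w).
Proof. by rewrite /s !rdotE rdot_tensor. Qed.

Let s_ge0 z : 0 <= rdot z (s z).
Proof. by rewrite rdot_s subr_ge0 x_le1. Qed.

Let s_le1 z : rdot z (s z) <= sq z.
Proof. by rewrite rdot_s gerBl sq_ge0. Qed.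

(** This is [x s^k]; the recursion stays inside the module, although [s] may lie
outside [B]. *)
Fixpoint residue (k : nat) : X :=
  if k is k'.+1 then residue k' - mact (residue k') (mip x x) else x.

Let residueE k z : t (residue k) z = t x (iter k s z).
Proof.
elim: k z => //= k ih z.
rewrite (linB (t_linearl z)) (it_balanced tensor _ _ (mip_in x x)).
by rewrite -(linB (t_linear _)) ih -iterSr.
Qed.

Definition polar_approx n : X := \sum_(k < n) (c k)%:C *: residue k.

Let polar_approxE n z : t (polar_approx n) z = \sum_(k < n) (c k)%:C *: t x (iter k s z).
Proof.
rewrite (lin_sum (t_linearl z)); apply: eq_bigr => k _.
by rewrite (linZ (t_linearl z)) residueE.
Qed.

Let D z k := moment s z k - moment s z k.+1.

Let D_ge0 z k : 0 <= D z k.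
Proof. by rewrite subr_ge0 moment_decr. Qed.

Let sum_D z n : \sum_(k < n) D z k = sq z - moment s z n.
Proof.
elim: n => [|n ih]; first by rewrite big_ord0 /moment /= subrr.
by rewrite big_ord_recr /= ih /D; lra.
Qed.

Let rdot_approx z n m : rdot (t (polar_approx n) z) (t (polar_approx m) z) =
  \sum_(i < n) \sum_(j < m) c i * c j * D z (i + j)%N.
Proof.
rewrite !polar_approxE rdot_suml; apply: eq_bigr => i _.
rewrite rdot_sumr; apply: eq_bigr => j _; rewrite !rdotE mulrA; congr (_ * _).
rewrite /D -addnS -!(rdot_iter s_sym) /= rdot_s; by ring.
Qed.

(** The limit [u] of [polar_approx] satisfies [<u|u> = 1 - q] with [q] the
projection onto the kernel of [x].  For [x = u <u|x>] one shows that
[w = x - u <u|x>] is orthogonal to [x]: [w] is orthogonal to [u], and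
[<u y, w z>] is the limit of [\sum c_k <s^k y, y>] when [y = <x|w> z], which is
at least its term of index [0], the squared norm of [y]. *)
Lemma polar_contraction : exists u, [/\ forall z, t u (mip u u z) = t u z,
  forall z, t u (mip u x z) = t x z &
  forall v, (forall z, mip v x z = 0) -> forall z, mip v u z = 0].
Proof.
have [q [lq hq qq]] := powers_tend s_linear s_sym s_ge0 s_le1.
have bound n z : sq (t (polar_approx n) z) <= 1 * sq z.
  rewrite /sq rdot_approx mul1r; apply: le_trans (invsqrt_square_le _ _ _) _ => //.
  by rewrite sum_D gerBl moment_ge0.
have cau z : exists y, tends (fun n => t (polar_approx n) z) y.
  apply: sq_cauchy_tends => e e0.
  have [l [_ hl hN]] := nonincreasing_ge0_lim (moment_ge0 s_sym s_ge0 z)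
    (moment_decr s_linear s_sym s_ge0 s_le1 z).
  have [|N lN] := hN (e / 2); first by rewrite divr_gt0.
  have up n m : rdot (t (polar_approx n) z) (t (polar_approx m) z) <= sq z - l.
    rewrite rdot_approx; apply: le_trans (invsqrt_square_le _ _ _) _ => //.
    by rewrite sum_D lerD2l lerN2.
  have lo n m : (N <= n)%N -> (N <= m)%N ->
      sq z - moment s z N <= rdot (t (polar_approx n) z) (t (polar_approx m) z).
    by move=> Nn Nm; rewrite rdot_approx -sum_D; exact: invsqrt_square_ge.
  exists N => m n Nm Nn; rewrite /sq !rdotE.
  have := up m m; have := up n n; have := lo m n Nm Nn; have := lo n m Nn Nm.
  by lra.
have [u hu] := module_limit bound cau.
have u_sq z : sq (t u z) = sq z - rdot z (q z).
  have hm := tends_rdot (y := z) (hq z).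
  have [l [ml hl _]] := nonincreasing_ge0_lim (moment_ge0 s_sym s_ge0 z)
    (moment_decr s_linear s_sym s_ge0 s_le1 z).
  have le : l = rdot z (q z) by apply: cvg_unique ml hm.
  apply: cvg_unique (tends_sq (hu z)) _ => //; rewrite -le.
  apply: (@squeeze_cvgr _ _ _ _ (fun n => sq z - moment s z n) (fun=> sq z - l)).
  - apply: nearW => n; rewrite -[sq (t _ _)]/(rdot _ _) rdot_approx; apply/andP; split.
      by rewrite -sum_D; exact: invsqrt_square_ge.
    apply: le_trans (invsqrt_square_le _ _ _) _ => //.
    by rewrite sum_D lerD2l lerN2.
  - by apply: cvgB => //; exact: cvg_cst.
  - exact: cvg_cst.
(* both sides of [<u|u> = 1 - q] are symmetric, so [u_sq] polarizes *)
have q_sym z w : rdot z (q w) = rdot (q z) w.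
  have h := tends_rdot (y := z) (hq w).
  have h' := tends_rdot (y := w) (hq z).
  rewrite (rdotC (q z)); apply: cvg_unique h _ => //.
  rewrite (_ : (fun _ => _) = fun k => rdot w (iter k s z)) //.
  by apply/funext => k; rewrite rdotC (iter_sym s_sym).
have p_sym z w : rdot z (mip u u w) = rdot (mip u u z) w.
  by rewrite -rdot_tensor rdotC rdot_tensor rdotC.
have uE z : mip u u z = z - q z.
  have lp := mip_linear u u.
  have diag v : rdot v (mip u u v) = rdot v v - rdot v (q v).
    by rewrite -rdot_tensor -/(sq _) u_sq.
  apply: rdot_inj => y; have := diag (y + z); have := diag y; have := diag z.
  rewrite (linD lp) (linD lq) !rdotE (p_sym z y) (q_sym z y).
  rewrite (rdotC (mip u u z) y) (rdotC (q z) y) (rdotC z y).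
  by lra.
have uq z : t u (q z) = 0 by apply: sq_eq0; rewrite u_sq qq subrr.
have u_p z : t u (mip u u z) = t u z.
  by rewrite uE (linB (t_linear _)) uq subr0.
exists u; split=> //; last first.
  move=> v vx z; apply: rdot_eq0 => w; rewrite -rdot_tensor.
  have h := tends_rdot (y := t v w) (hu z).
  apply: cvg_unique h _ => //.
  rewrite (_ : (fun _ => _) = fun=> 0); first exact: cvg_cst.
  apply/funext => n; rewrite polar_approxE rdot_sumr big1 // => k _.
  by rewrite rdotZr rdot_tensor vx rdot0r mulr0.
move=> z; pose w := t x z - t u (mip u x z).
have w_u y : rdot (t u y) w = 0.
  by rewrite /w !rdotE rdot_tensor [X in _ - X]rdot_tensor p_sym -!rdot_tensor u_p subrr.
pose y := mip x x z - mip x u (mip u x z).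
have yE v : rdot v y = rdot (t x v) w.
  by rewrite /y /w !rdotE !rdot_tensor.
have y0 : sq y <= 0.
  have h := tends_rdot (y := w) (hu y).
  rewrite -(w_u y) rdotC -(cvg_lim _ h) //; apply: limr_ge.
    by apply/cvg_ex; eexists; exact: h.
  exists 1%N => // n /= n1; rewrite rdotC polar_approxE rdot_suml.
  case: n n1 => // n _; rewrite big_ord_recl /= rdotZl mul1r -yE.
  rewrite lerDl; apply: sumr_ge0 => k _.
  rewrite rdotZl -yE; apply: mulr_ge0; first exact: (@invsqrt_coef_ge0 R k.+1).
  by rewrite rdotC; exact: (moment_ge0 s_sym s_ge0 y k.+1).
have w_x v : rdot (t x v) w = 0.
  by rewrite -yE (sq_eq0 (x := y)) ?rdot0r //; apply/le_anti; rewrite y0 sq_ge0.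
apply/esym/subr0_eq/sq_eq0; rewrite -/w /sq {1}/w rdotDl rdotNl w_u w_x.
by rewrite subrr.
Qed.

End PolarContraction.

(** By the last clause, normalizing keeps the orthogonality that Gram-Schmidt has
achieved. *)
Lemma polar (y : X) : exists u, [/\ forall z, t u (mip u u z) = t u z,
  forall z, t u (mip u y z) = t y z &
  forall v, (forall z, mip v y z = 0) -> forall z, mip v u z = 0].
Proof.
have [C C0 hC] := tensor_le y.
pose r : R := (1 + C)^-1.
have r0 : 0 < r by rewrite invr_gt0 addr_gt0.
have tZ z : t (r%:C *: y) z = r%:C *: t y z by rewrite (linZ (t_linearl z)).
have mZ v z : mip v (r%:C *: y) z = r%:C *: mip v y z by rewrite mipZr.
have [|u [u1 u2 u3]] := @polar_contraction (r%:C *: y).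
  move=> z; rewrite tZ /sq !rdotE -/(sq _) mulrA.
  apply: le_trans (_ : r * r * (C * sq z) <= _); first by rewrite ler_wpM2l // mulr_ge0 // ltW.
  rewrite mulrA ler_piMl ?sq_ge0 // /r -invfM mulrC ler_pdivrMr ?mulr_gt0 ?addr_gt0 //.
  by nra.
have rn0 : r%:C != 0 :> R[i] by rewrite fmorph_eq0 gt_eqF.
exists u; split=> //.
  move=> z; apply: (scalerI rn0); rewrite -tZ -u2 mZ.
  by rewrite (linZ (t_linear u)).
move=> v vy; apply: u3 => z; by rewrite mZ vy scaler0.
Qed.

End InteriorTensor.

(** * Orthonormal bases *)

(** A convergence test for series: the tails are controlled by those of a
bounded series of nonnegative numbers. *)
Lemma series_tends (R : realType) (H : hilbertType R) (F : nat -> H)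
    (f : nat -> R) (D M : R) : 0 < D -> (forall n, 0 <= f n) ->
  (forall n, \sum_(i < n) f i <= M) ->
  (forall n m, (n <= m)%N ->
    sq (\sum_(n <= i < m) F i) <= D * \sum_(n <= i < m) f i) ->
  exists x, tends (fun n => \sum_(i < n) F i) x.
Proof.
move=> D0 f0 fM FD.
have [||l [_ hl hN]] := @nonincreasing_ge0_lim R (fun n => M - \sum_(i < n) f i).
- by move=> n; rewrite subr_ge0.
- by move=> n; rewrite big_ord_recr /= lerD2l lerN2 lerDl.
apply: sq_cauchy_tends => e e0.
have [|N lN] := hN (e / D); first by rewrite divr_gt0.
have key n m : (N <= n)%N -> (n <= m)%N ->
    sq (\sum_(i < m) F i - \sum_(i < n) F i) <= e.
  move=> Nn nm; rewrite -!(big_mkord xpredT F) (big_cat_nat (n := n)) //=.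
  rewrite addrAC subrr add0r; apply: le_trans (FD _ _ nm) _.
  rewrite mulrC -ler_pdivlMr //.
  have := hl m; have h0 : \sum_(i < N) f i <= \sum_(i < n) f i.
    rewrite -!(big_mkord xpredT f) (big_cat_nat (n := N) (p := n)) //= lerDl.
    by apply: sumr_ge0 => i _.
  have : \sum_(i < m) f i = \sum_(i < n) f i + \sum_(n <= i < m) f i.
    by rewrite -!(big_mkord xpredT f) (big_cat_nat (n := n)).
  by lra.
exists N => m n Nm Nn; have [nm|/ltnW mn] := leqP n m; first exact: key.
rewrite -opprB /sq rdotNl rdotNr opprK; exact: key.
Qed.

Section Orthonormal.
Context {R : realType} {H : hilbertType R} {B : set (H -> H)} (X : cstar_module B).
Context (K : hilbertType R) (t : X -> H -> K).
Hypothesis algB : concrete_cstar_algebra B.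
Hypothesis tensor : is_interior_tensor t.
Hypothesis closed_t : wot_seq_closed (range t).

Let t_linear := it_linearr tensor.
Let t_linearl := it_linearl tensor.
Let rdotT := rdot_tensor tensor.

(** The first condition makes [<u_i|u_i>] a projection with [u_i <u_i|u_i> = u_i],
possibly smaller than the identity; the last one is totality. *)
Definition orthonormal (u : nat -> X) :=
  [/\ forall i z, t (u i) (mip (u i) (u i) z) = t (u i) z,
      forall i j z, i != j -> mip (u i) (u j) z = 0 &
      forall y, (forall i z, mip (u i) y z = 0) -> y = 0].

Lemma mip0_sym (x y : X) : (forall z, mip x y z = 0) -> forall z, mip y x z = 0.
Proof.
by move=> xy z; apply: rdot_eq0 => w; rewrite -rdotT rdotC rdotT xy rdot0r.
Qed.

Lemma mip_sym (x : X) z w : rdot z (mip x x w) = rdot (mip x x z) w.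
Proof. by rewrite -rdotT rdotC rdotT rdotC. Qed.

(** [res n x] is [x] with its components along [u_0], ..., [u_(n-1)]
removed, and [u_n] is the polar part of [res n g_n], where the [g_n] generate
the module.  If [y] is orthogonal to every [u_n] then the removal does not change
inner products with [y], so that [y] is orthogonal to every [g_n], hence to
itself. *)
Lemma gram_schmidt : sigma_star_countably_generated X -> exists u, orthonormal u.
Proof.
case=> g hg.
have [pol hpol] : exists pol : X -> X, forall y, [/\
    forall z, t (pol y) (mip (pol y) (pol y) z) = t (pol y) z,
    forall z, t (pol y) (mip (pol y) y z) = t y z &
    forall v, (forall z, mip v y z = 0) -> forall z, mip v (pol y) z = 0].
  exists (fun y => projT1 (cid (polar algB tensor closed_t y))) => y.
  by case: (cid _).
pose res := fix res n (x : X) : X := if n is m.+1 then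
  let u := pol (res m (g m)) in res m x - mact u (mip u (res m x)) else x.
pose u n := pol (res n (g n)).
have resS n x z : t (res n.+1 x) z = t (res n x) z - t (u n) (mip (u n) (res n x) z).
  by rewrite /= (linB (t_linearl z)) (it_balanced tensor _ _ (mip_in _ _)).
have idem i z : t (u i) (mip (u i) (u i) z) = t (u i) z by case: (hpol (res i (g i))).
have ores n i x z : (i < n)%N -> mip (u i) (res n x) z = 0.
  elim: n i x z => // n ih i x z; rewrite ltnS leq_eqVlt => /orP[/eqP ->|i_n];
    apply: rdot_eq0 => w; rewrite -rdotT resS rdotDr rdotNr.
    by rewrite [X in _ - X]rdotT mip_sym -!rdotT idem subrr.
  rewrite !rdotT ih // rdot0r.
  have [_ _ ou] := hpol (res n (g n)).
  by rewrite (ou (u i) (fun z => ih i (g n) z i_n)) rdot0r subrr.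
have orth i j z : (i < j)%N -> mip (u i) (u j) z = 0.
  move=> ij; have [_ _ ou] := hpol (res j (g j)).
  by apply: ou => w; exact: ores.
exists u; split=> //.
  move=> i j z; rewrite neq_ltn => /orP[|ij]; first exact: orth.
  by apply: mip0_sym => w; exact: orth.
move=> y uy.
have res_y n x z w : rdot (t (res n x) z) (t y w) = rdot (t x z) (t y w).
  elim: n => // n ih; rewrite resS rdotDl rdotNl ih [X in _ - X]rdotT uy rdot0r.
  by rewrite subr0.
have gy n z w : rdot (t (g n) z) (t y w) = 0.
  rewrite -(res_y n); have [_ <- _] := hpol (res n (g n)).
  by rewrite -/(u n) rdotT uy rdot0r.
apply: (tensor_eq0 tensor) => z; apply: sq_eq0; rewrite /sq rdotT.
suff -> : mip y y z = 0 by rewrite rdot0r.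
suff : [set x : X | forall z, mip x y z = 0] = setT by move/seteqP => -[_ /(_ y I)].
apply: hg.
  move=> N b Bb /= v; apply: rdot_eq0 => w; rewrite -rdotT (lin_sum (t_linearl w)).
  by rewrite rdot_suml big1 // => i _; rewrite (it_balanced tensor) // gy.
move=> x_ x x0 /(_ y) /wot_cvgP h v; apply: rdot_eq0 => w.
apply: cvg_unique (h v w) _ => //.
have x0' n v' : mip (x_ n) y v' = 0 := x0 n v'.
rewrite (_ : (fun _ => _) = fun=> 0); first exact: cvg_cst.
by apply/funext => n; rewrite x0' rdot0r.
Qed.

Section Basis.
Variable u : nat -> X.
Hypothesis ou : orthonormal u.

Let p i := mip (u i) (u i) : H -> H.

Lemma basis_proj_sym i z w : rdot z (p i w) = rdot (p i z) w.
Proof. exact: mip_sym. Qed.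

Lemma basis_proj_mip i (y : X) z : p i (mip (u i) y z) = mip (u i) y z.
Proof.
have [idem _ _] := ou.
by apply: rdot_inj => w; rewrite basis_proj_sym -!rdotT idem.
Qed.

Lemma basis_projK i z : p i (p i z) = p i z.
Proof. exact: basis_proj_mip. Qed.

Lemma basis_sq_le i z : sq (t (u i) z) <= sq z.
Proof.
rewrite /sq rdotT -/(p i).
have := sq_ge0 (z - p i z); rewrite /sq !rdotE.
rewrite -[rdot (p i z) (p i z)]basis_proj_sym basis_projK (rdotC (p i z)).
by lra.
Qed.

Lemma basis_orth i j z w : i != j -> rdot (t (u i) z) (t (u j) w) = 0.
Proof. by have [_ orth _] := ou; move=> ij; rewrite rdotT orth // rdot0r. Qed.

Lemma basis_sum_sq (z : nat -> H) n m :
  sq (\sum_(n <= i < m) t (u i) (z i)) = \sum_(n <= i < m) sq (t (u i) (z i)).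
Proof.
rewrite /sq rdot_suml; apply: eq_big_nat => i /andP[ni im].
rewrite rdot_sumr (big_cat_nat (n := i)) //= 1?ltnW // (@big_ltn _ _ _ i m) //.
rewrite big_nat_cond big1 ?add0r => [|j /andP[/andP[_ ji] _]]; last first.
  by rewrite basis_orth // gt_eqF.
rewrite big_nat_cond big1 ?addr0 // => j /andP[/andP[ji _] _].
by rewrite basis_orth // lt_eqF.
Qed.

(** The Riesz-Fischer theorem, with operators as coefficients: the partial sums are
uniformly bounded and converge strongly, so the sum exists in the module. *)
Lemma riesz_fischer (a : nat -> H -> H) (C : R) :
  (forall i, B (a i)) -> (forall n z, \sum_(i < n) sq (a i z) <= C * sq z) ->
  exists x : X, (forall z, tends (fun n => \sum_(i < n) t (u i) (a i z)) (t x z)) /\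
    forall i z, mip (u i) x z = p i (a i z).
Proof.
move=> Ba aC.
pose xn n := \sum_(i < n) mact (u i) (a i).
have xnE n z : t (xn n) z = \sum_(i < n) t (u i) (a i z).
  rewrite (lin_sum (t_linearl z)); apply: eq_bigr => i _.
  by rewrite (it_balanced tensor).
have le_ n m z : sq (\sum_(n <= i < m) t (u i) (a i z)) <= \sum_(n <= i < m) sq (a i z).
  by rewrite basis_sum_sq; apply: ler_sum => i _; exact: basis_sq_le.
have [||x hx] := @module_limit _ _ _ _ _ _ tensor closed_t xn C.
- move=> n z; rewrite xnE; apply: le_trans (aC n z).
  by have := le_ 0%N n z; rewrite !big_mkord.
- move=> z.
  have [|x hx] := @series_tends _ _ (fun i => t (u i) (a i z)) (fun i => sq (a i z))
    _ _ ltr01 (fun i => sq_ge0 _) (fun n => aC n z).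
    by move=> n m _; rewrite mul1r.
  by exists x; under eq_fun do rewrite xnE.
exists x; split; first by move=> z; have := hx z; under eq_fun do rewrite xnE.
move=> i z; apply: rdot_inj => w; rewrite -[in LHS]rdotT.
have h := tends_rdot (y := t (u i) w) (hx z).
apply: cvg_unique h _ => //; apply: cvg_near_cst; exists i.+1 => // n /= i_n.
rewrite xnE rdot_sumr (bigD1 (Ordinal i_n)) //= big1 ?addr0 ?rdotT // => j ji.
by rewrite basis_orth // eq_sym.
Qed.

(** By Bessel's inequality the coordinates of [y] can be summed; the sum has the
same coordinates as [y], so it is [y] by totality. *)
Lemma parseval (y : X) z :
  tends (fun n => \sum_(i < n) t (u i) (mip (u i) y z)) (t y z).
Proof.
have [C C0 hC] := tensor_le algB tensor y.
have bessel n w : \sum_(i < n) sq (mip (u i) y w) <= C * sq w.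
  apply: le_trans (hC w); set v := \sum_(i < n) t (u i) (mip (u i) y w).
  have vy : rdot v (t y w) = \sum_(i < n) sq (mip (u i) y w).
    by rewrite rdot_suml; apply: eq_bigr => i _; rewrite rdotT.
  have vv : sq v <= \sum_(i < n) sq (mip (u i) y w).
    have := basis_sum_sq (fun i => mip (u i) y w) 0 n; rewrite !big_mkord => ->.
    by apply: ler_sum => i _; exact: basis_sq_le.
  have := sq_ge0 (t y w - v); rewrite /sq !rdotE (rdotC (t y w)) vy.
  by move: vv; rewrite /sq; lra.
have [x [hx xu]] := riesz_fischer (fun i => mip_in (u i) y) bessel.
suff e : x = y by have := hx z; rewrite e.
have [_ _ tot] := ou; apply/subr0_eq/tot => i w; apply: rdot_eq0 => v.
rewrite -rdotT (linB (t_linearl w)) rdotDr rdotNr !rdotT xu.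
by rewrite basis_proj_mip subrr.
Qed.

End Basis.
End Orthonormal.

(** * Square-summable sequences of vectors *)

Section SquareSummable.
Context {R : realType} {H : hilbertType R}.
Implicit Types a b : nat -> H.

(** Extended-real valued, so that it can be rearranged and added without
summability conditions. *)
Definition sqsum a : \bar R := (\sum_(0 <= n <oo) (sq (a n))%:E)%E.

Lemma sqsum_ge0 a : (0 <= sqsum a)%E.
Proof. by apply: nneseries_ge0 => n _ _; rewrite lee_fin sq_ge0. Qed.

Lemma sqsum_le a (C : R) :
  (sqsum a <= C%:E)%E <-> forall n, \sum_(i < n) sq (a i) <= C.
Proof.
have s0 i : (0 <= (sq (a i))%:E)%E by rewrite lee_fin sq_ge0.
split=> [h n|h].
  rewrite -lee_fin; apply: le_trans h; rewrite -sumEFin.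
  rewrite -(big_mkord xpredT (fun i => (sq (a i))%:E)).
  by apply: nneseries_lim_ge => i _ _.
apply: lime_le; first by apply: is_cvg_nneseries => i _ _.
by apply: nearW => n; rewrite big_mkord sumEFin lee_fin.
Qed.

Lemma sqsum_cvg a : (sqsum a < +oo)%E ->
  (fun n => \sum_(i < n) sq (a i)) @ \oo --> fine (sqsum a).
Proof.
move=> afin; have : cvgn (fun n => \sum_(0 <= i < n) (sq (a i))%:E)%E.
  by apply: is_cvg_nneseries => i _ _; rewrite lee_fin sq_ge0.
rewrite -/(sqsum a) => h.
have {}h : (fun n => \sum_(0 <= i < n) (sq (a i))%:E)%E @ \oo --> (fine (sqsum a))%:E.
  by rewrite fineK // ge0_fin_numE ?sqsum_ge0.
have -> : (fun n => \sum_(i < n) sq (a i)) =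
    fine \o (fun n => \sum_(0 <= i < n) (sq (a i))%:E)%E.
  by apply/funext => n /=; rewrite sumEFin big_mkord.
exact: fine_cvg h.
Qed.

Lemma cvg_sqsum a (L : R) :
  (fun n => \sum_(i < n) sq (a i)) @ \oo --> L -> sqsum a = L%:E.
Proof.
move=> h; apply/cvg_lim => //.
rewrite (_ : (fun n => _) = EFin \o (fun n => \sum_(i < n) sq (a i))).
  by apply: cvg_EFin => //; exact: nearW.
by apply/funext => n; rewrite big_mkord sumEFin.
Qed.

Lemma sqsumN a : sqsum (- a) = sqsum a.
Proof.
by apply: eq_eseriesr => i _; rewrite /sq /= rdotNl rdotNr opprK.
Qed.

Lemma sqsumD_fin a b :
  (sqsum a < +oo)%E -> (sqsum b < +oo)%E -> (sqsum (a + b)%R < +oo)%E.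
Proof.
move=> ha hb.
have fin c : (sqsum c < +oo)%E -> sqsum c = (fine (sqsum c))%:E.
  by move=> hc; rewrite fineK // ge0_fin_numE ?sqsum_ge0.
have /sqsum_le la : (sqsum a <= (fine (sqsum a))%:E)%E by rewrite -fin.
have /sqsum_le lb : (sqsum b <= (fine (sqsum b))%:E)%E by rewrite -fin.
apply: (@le_lt_trans _ _ (2 * fine (sqsum a) + 2 * fine (sqsum b))%:E);
  last exact: ltry.
apply/sqsum_le => n; apply: le_trans (lerD (ler_wpM2l _ (la n)) (ler_wpM2l _ (lb n))) => //.
rewrite !mulr_sumr -big_split /=; apply: ler_sum => i _.
have := sq_ge0 (a i - b i); rewrite /sq /= !rdotE (rdotC (b i)).
by lra.
Qed.

(** Inner product of square-summable sequences, by polarization *)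
Definition sqdot a b : R := (fine (sqsum (a + b)) - fine (sqsum (a - b))) / 4.

Lemma sqdot_cvg a b : (sqsum a < +oo)%E -> (sqsum b < +oo)%E ->
  (fun n => \sum_(i < n) rdot (a i) (b i)) @ \oo --> sqdot a b.
Proof.
move=> ha hb.
rewrite (_ : (fun _ => _) = fun n =>
  (\sum_(i < n) sq ((a + b) i) - \sum_(i < n) sq ((a - b) i)) / 4).
  apply: cvgM; last exact: cvg_cst.
  by apply: cvgB; apply: sqsum_cvg; apply: sqsumD_fin => //; rewrite sqsumN.
apply/funext => n; rewrite -sumrB mulr_suml; apply: eq_bigr => i _.
by rewrite /sq /= !rdotE (rdotC (b i)); field.
Qed.

End SquareSummable.

(** * The column module *)

Section ColumnModule.
Context {R : realType} {H : hilbertType R} {B : set (H -> H)}.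
Hypothesis algB : concrete_cstar_algebra B.
Hypothesis closed_B : wot_seq_closed B.
Implicit Types b c : nat -> H -> H.

Local Notation col b z := (fun n => b n z).

Lemma alg_sum (I : Type) (r : seq I) (P : pred I) (F : I -> H -> H) :
  (forall i, P i -> B (F i)) -> B (\sum_(i <- r | P i) F i).
Proof.
move=> BF; elim/big_ind: _ => //; first exact: csa0.
by move=> x y; exact: csaD.
Qed.

Lemma alg_sub (b c : H -> H) : B b -> B c -> B (b - c).
Proof.
by move=> Bb Bc; apply: (csaD algB) => //; rewrite -scaleN1r; exact: (csaZ algB).
Qed.

(** The value that [adjoint] picks is a genuine adjoint, and unique. *)
Lemma adjointP (b : H -> H) : B b -> B (adjoint b) /\ is_adjoint b (adjoint b).
Proof.
move=> Bb; have [b' Bb' bb'] := csa_adjoint algB Bb.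
have e : is_adjoint b (adjoint b) by rewrite /adjoint; case: xgetP => // /(_ b').
suff -> : adjoint b = b' by [].
apply/funext => x; apply: rdot_inj => z.
by rewrite /rdot -e -bb'.
Qed.

Lemma rdot_adjoint (b : H -> H) z w : B b -> rdot z (adjoint b w) = rdot (b z) w.
Proof. by move=> /adjointP[_ e]; rewrite /rdot e. Qed.

(** Boundedness of the column operator [z |-> (b_i z)_i] from [H] to the space
of square-summable sequences. *)
Definition column_bounded b :=
  exists2 C : R, 0 < C & forall n z, \sum_(i < n) sq (b i z) <= C * sq z.

Lemma column_bounded_fin b z : column_bounded b -> (sqsum (col b z) < +oo)%E.
Proof.
case=> C _ hC; apply: (@le_lt_trans _ _ (C * sq z)%:E); last exact: ltry.
by apply/sqsum_le => n; exact: hC.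
Qed.

Let partial b c n := \sum_(i < n) (adjoint (b i) \o c i).

Let partialE b c n z : partial b c n z = \sum_(i < n) adjoint (b i) (c i z).
Proof. by rewrite /partial fct_sumE. Qed.

Let partial_in b c n : (forall i, B (b i)) -> (forall i, B (c i)) -> B (partial b c n).
Proof.
move=> Bb Bc; apply: alg_sum => i _; apply: (csaM algB) => //.
by have [] := adjointP (Bb i).
Qed.

Let rdot_partial b c n z w : (forall i, B (b i)) ->
  rdot z (partial b c n w) = \sum_(i < n) rdot (b i z) (c i w).
Proof.
move=> Bb; rewrite partialE rdot_sumr; apply: eq_bigr => i _.
by rewrite rdot_adjoint.
Qed.

(** Even strong convergence holds.  For [v] a tail of the series at [w], the
squared norm of [v] is the sum of the [<b_i v, c_i w>]; the weights of
[rdot_le] are chosen so that the bound of [b] absorbs half of it. *)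
Lemma column_product b c : (forall i, B (b i)) -> (forall i, B (c i)) ->
  column_bounded b -> column_bounded c ->
  exists2 a, bounded_op a & wot_cvg (partial b c) a.
Proof.
move=> Bb Bc [C C0 hC] [C' C'0 hC'].
have key n m w : (n <= m)%N ->
    sq (\sum_(n <= i < m) adjoint (b i) (c i w)) <= C * \sum_(n <= i < m) sq (c i w).
  move=> nm; set v := \sum_(n <= i < m) _.
  have e : sq v = \sum_(n <= i < m) rdot (b i v) (c i w).
    by rewrite {1}/sq {2}/v rdot_sumr; apply: eq_bigr => i _; rewrite rdot_adjoint.
  have le1 : \sum_(n <= i < m) sq (b i v) <= C * sq v.
    apply: le_trans (hC m v); rewrite -(big_mkord xpredT (fun i => sq (b i v))).
    rewrite [leRHS](big_cat_nat (n := n)) //= lerDr.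
    by apply: sumr_ge0 => i _; exact: sq_ge0.
  have : 2 * sq v <= C^-1 * \sum_(n <= i < m) sq (b i v) + C * \sum_(n <= i < m) sq (c i w).
    rewrite e !mulr_sumr -big_split /=; apply: ler_sum => i _.
    rewrite -{2}[C]invrK; apply: rdot_le; by rewrite invr_gt0.
  have : C^-1 * \sum_(n <= i < m) sq (b i v) <= sq v.
    by rewrite mulrC ler_pdivrMr // mulrC.
  by lra.
have [||z|a ba ha] := @tends_bounded_op _ _ _ (partial b c) (C * C').
- by move=> n; have [] := csa_bounded algB (partial_in n Bb Bc).
- move=> n z; rewrite partialE; have := key 0%N n z (leq0n _); rewrite !big_mkord.
  by move/le_trans; apply; rewrite -mulrA ler_pM2l.
- have [|x hx] := @series_tends _ _ (fun i => adjoint (b i) (c i z))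
    (fun i => sq (c i z)) C (C' * sq z) C0 (fun i => sq_ge0 _) (fun n => hC' n z).
    by move=> n m; exact: key.
  by exists x; under eq_fun do rewrite partialE.
by exists a => //; exact: wot_cvg_tends.
Qed.

(** Membership in the column module is a mere bound: the limit operator exists by
[column_product] and is in [B] by weak sequential closedness. *)
Lemma CwP b : iset (i := Cw B) b <-> (forall i, B (b i)) /\ column_bounded b.
Proof.
split=> [[Bb [a Ba /wot_cvgP ha]]|[Bb bb]]; split=> //.
  have [C C0 hC] := bounded_op_le (csa_bounded algB Ba).
  exists (1 + C); first by rewrite addr_gt0.
  move=> n z; apply: le_trans (_ : rdot z (a z) <= _).
    have e m : rdot z (partial b b m z) = \sum_(i < m) sq (b i z) by rewrite rdot_partial.
    rewrite -e -(cvg_lim _ (ha z z)) //; apply: nondecreasing_cvgn_le; last first.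
      by apply/cvg_ex; eexists; exact: (ha z z).
    apply/nondecreasing_seqP => m; rewrite -/(partial b b m) -/(partial b b m.+1) !e.
    by rewrite big_ord_recr /= lerDl sq_ge0.
  have := rdot_le z (a z) ltr01; have := hC z; rewrite invr1 !mul1r.
  by have := sq_ge0 z; have := sq_ge0 (a z); nra.
have [a ba ha] := column_product Bb Bb bb bb.
exists a => //; apply: (closed_B _ ba ha) => n; exact: partial_in.
Qed.

Lemma Cw_iipP b c : iset (i := Cw B) b -> iset (i := Cw B) c ->
  bounded_op (iip (i := Cw B) b c) /\
  forall z w, rdot z (iip (i := Cw B) b c w) = sqdot (col b z) (col c w).
Proof.
move=> /CwP[Bb bb] /CwP[Bc bc].
have [a ba ha] := column_product Bb Bc bb bc.
have [bi hi] : bounded_op (wot_lim (partial b c)) /\ wot_cvg (partial b c) (wot_lim (partial b c)).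
  by rewrite /wot_lim; case: xgetP => [? -> //|/(_ a)[]].
split=> // z w; move/wot_cvgP: hi => hi; apply: cvg_unique (hi w z) _ => //.
rewrite (_ : (fun n => _) = fun n => \sum_(i < n) rdot (b i z) (c i w)); last first.
  by apply/funext => n; rewrite rdot_partial.
by apply: sqdot_cvg; exact: column_bounded_fin.
Qed.

End ColumnModule.

(** * The Eilenberg swindle *)

Lemma nat_pairing : exists (code : nat * nat -> nat) (dec : nat -> nat * nat),
  cancel code dec /\ cancel dec code.
Proof.
have /card_set_bijP[f] := card_nat2; rewrite setTT_bijective => -[g fg gf].
by exists f, g.
Qed.

Section Swindle.
Context {R : realType} {H : hilbertType R}.
Variables (code : nat * nat -> nat) (dec : nat -> nat * nat).
Hypothesis codeK : cancel code dec.
Hypothesis decK : cancel dec code.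
Variable p : nat -> H -> H.
Hypothesis p_linear : forall i, linear (p i).
Hypothesis p_sym : forall i z w, rdot z (p i w) = rdot (p i z) w.
Hypothesis p_idem : forall i z, p i (p i z) = p i z.
Implicit Types al be ga : nat -> H.

Lemma sqsum_code ga :
  sqsum ga = (\sum_(0 <= i <oo) \sum_(0 <= j <oo) (sq (ga (code (i, j))))%:E)%E.
Proof.
have s0 v : (0 <= (sq (v : H))%:E)%E by rewrite lee_fin sq_ge0.
rewrite /sqsum nneseries_esumT //.
rewrite (@reindex_esum _ _ _ [set: nat * nat] _ code); last first.
  by rewrite setTT_bijective; exists dec.
rewrite nneseries_esumT => [|i]; last by apply: nneseries_ge0.
under [RHS]eq_esum do rewrite nneseries_esumT //.
rewrite esum_esum //; congr (esum _ _); last by apply/funext => -[].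
by apply/seteqP; split.
Qed.

(** In the block [i], the components of [be] in the range of [p i] move one place
up, and [al i] takes the place that becomes free. *)
Definition swindle al be (n : nat) : H :=
  let: (i, j) := dec n in
  be n - p i (be n) + (if j is j'.+1 then p i (be (code (i, j'))) else al i).

Lemma swindle_code al be i j : swindle al be (code (i, j)) =
  be (code (i, j)) - p i (be (code (i, j))) +
  (if j is j'.+1 then p i (be (code (i, j'))) else al i).
Proof. by rewrite /swindle codeK. Qed.

Lemma swindle_linear l al be al' be' :
  swindle (l *: al + al') (l *: be + be') = l *: swindle al be + swindle al' be'.
Proof.
apply/funext => n; rewrite [RHS]/GRing.add /= [in RHS]/GRing.scale /= /swindle.
case: (dec n) => i j.
have lincomb (x x' y y' g g' : H) : (l *: x + x') - (l *: y + y') + (l *: g + g') =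
    l *: (x - y + g) + (x' - y' + g').
  by rewrite !scalerDr scalerN opprD [RHS]addrACA [X in _ = X + _]addrACA.
by rewrite -lincomb !(p_linear i l); case: j => [|j] //; rewrite (p_linear i l).
Qed.

Lemma swindleD al be al' be' :
  swindle al be + swindle al' be' = swindle (al + al') (be + be').
Proof. by have := swindle_linear 1 al be al' be'; rewrite !scale1r. Qed.

Lemma swindleB al be al' be' :
  swindle al be - swindle al' be' = swindle (al - al') (be - be').
Proof.
have := swindle_linear (-1) al' be' al be.
by rewrite !scaleN1r ![- _ + _]addrC => ->.
Qed.

(** In each block, Pythagoras splits the sum of squares over [p i] and its
complement; the parts in the range of [p i] are the same on both sides up to a
shift of the index. *)
Lemma sqsum_swindle al be : (forall i, p i (al i) = al i) ->
  sqsum (swindle al be) = (sqsum al + sqsum be)%E.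
Proof.
move=> pal.
have s0 v : (0 <= (sq (v : H))%:E)%E by rewrite lee_fin sq_ge0.
have pyth i v w : p i w = w -> sq (v - p i v + w) = sq (v - p i v) + sq w.
  move=> pw; suff e : rdot (v - p i v) w = 0.
    move: (v - p i v) e => v' e.
    by rewrite /sq rdotDl !rdotDr e (rdotC w) e addr0 add0r.
  by rewrite -pw p_sym (linB (p_linear i)) p_idem subrr rdot0l.
rewrite [LHS]sqsum_code (sqsum_code be) {1}/sqsum -nneseriesD //; last first.
  by move=> i _ _; apply: nneseries_ge0.
apply: eq_eseriesr => i _.
pose G j : H := if j is j'.+1 then p i (be (code (i, j'))) else al i.
have pG j : p i (G j) = G j by case: j => [|j]; [exact: pal|exact: p_idem].
rewrite (_ : (\sum_(0 <= j <oo) (sq (swindle al be (code (i, j))))%:E)%E =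
   (\sum_(0 <= j <oo) ((sq (be (code (i, j)) - p i (be (code (i, j)))))%:E
      + (sq (G j))%:E))%E); last first.
  by apply: eq_eseriesr => j _; rewrite swindle_code pyth // pG.
rewrite nneseriesD // (nneseries_recl (f := fun j => (sq (G j))%:E)) //.
rewrite -(nneseries_addn (f := fun j => (sq (G j))%:E)) // addeCA; congr (_ + _)%E.
rewrite -nneseriesD //.
apply: eq_eseriesr => j _; rewrite addn1 /= -EFinD -pyth //.
by rewrite subrK.
Qed.

Lemma sqdot_swindle al be al' be' :
  (forall i, p i (al i) = al i) -> (forall i, p i (al' i) = al' i) ->
  (sqsum al < +oo)%E -> (sqsum be < +oo)%E ->
  (sqsum al' < +oo)%E -> (sqsum be' < +oo)%E ->
  sqdot (swindle al be) (swindle al' be') = sqdot al al' + sqdot be be'.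
Proof.
move=> pal pal' fa fb fa' fb'.
rewrite /sqdot swindleB swindleD !sqsum_swindle; first last.
- by move=> i; rewrite (linD (p_linear i)) pal pal'.
- by move=> i; rewrite (linB (p_linear i)) pal pal'.
have fin (c : nat -> H) : (sqsum c < +oo)%E -> sqsum c \is a fin_num.
  by move=> hc; rewrite ge0_fin_numE ?sqsum_ge0.
by rewrite !fineD ?fin ?sqsumD_fin ?sqsumN //; field.
Qed.

End Swindle.

Theorem theorem4p19 (R : realType) (H : hilbertType R) (B : set (H -> H))
    (X : cstar_module B) :
  sigma_star_algebra B ->
  sigma_star_module X ->
  sigma_star_countably_generated X ->
  unitarily_equivalent B (ip_sum (ip_module_of X) (Cw B)) (Cw B).
Proof.
move=> [algB _ closed_B] [K [t [tensor closed_t]]] gen.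
have [u ou] := gram_schmidt algB tensor closed_t gen.
have [code [dec [codeK decK]]] := nat_pairing.
pose p i := mip (u i) (u i) : H -> H.
have Bp i : B (p i) by exact: mip_in.
have p_lin i : linear (p i) by exact: (mip_linear algB).
have p_sym i z w : rdot z (p i w) = rdot (p i z) w by exact: (mip_sym tensor).
have p_idem i z : p i (p i z) = p i z by exact: (basis_projK tensor ou).
have p_mip i (x : X) z : p i (mip (u i) x z) = mip (u i) x z.
  exact: (basis_proj_mip tensor ou).
pose V := swindle code dec p.
pose al (x : X) z i := mip (u i) x z.
pose U (x : X * (nat -> H -> H)) : nat -> H -> H := fun n z =>
  V (al x.1 z) (fun m => x.2 m z) n.
have al_cvg x y z w : (fun n => \sum_(i < n) rdot (al x z i) (al y w i)) @ \oo
    --> rdot z (mip x y w).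
  have := tends_rdot (y := t x z) (parseval algB tensor closed_t ou y w).
  rewrite rdot_tensor //; apply: cvg_trans; apply: near_eq_cvg; apply: nearW => n.
  rewrite rdot_sumr; apply: eq_bigr => i _.
  by rewrite rdotC rdot_tensor // rdotC.
have al_sq x z : sqsum (al x z) = (sq (t x z))%:E.
  by apply: cvg_sqsum; rewrite /sq rdot_tensor //; exact: al_cvg.
have al_fin x z : (sqsum (al x z) < +oo)%E by rewrite al_sq ltry.
have al_dot x y z w : sqdot (al x z) (al y w) = rdot z (mip x y w).
  by apply: cvg_unique (sqdot_cvg (al_fin x z) (al_fin y w)) (al_cvg x y z w).
have U_sq x z : sqsum (fun n => U x n z) =
    ((sq (t x.1 z))%:E + sqsum (fun n => x.2 n z))%E.
  rewrite -al_sq; apply: (sqsum_swindle codeK decK p_lin p_sym p_idem) => i.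
  exact: p_mip.
have U_in x : iset (i := ip_sum (ip_module_of X) (Cw B)) x -> iset (i := Cw B) (U x).
  case: x => x b; move=> [_ /= /(CwP algB closed_B) [Bb [C C0 hC]]].
  apply/(CwP algB closed_B); split.
    move=> n; rewrite /U /V /swindle /=; case: (dec n) => i j.
    have -> : (fun z => b n z - p i (b n z) +
       match j with 0%N => al x z i | j'.+1 => p i (b (code (i, j')) z) end) =
       (b n - (p i \o b n)) + (if j is j'.+1 then p i \o b (code (i, j')) else mip (u i) x).
      by apply/funext => z; case: j.
    apply: (csaD algB); first by apply: alg_sub => //; exact: (csaM algB).
    by case: j => [|j]; [exact: mip_in|exact: (csaM algB)].
  have [D D0 hD] := tensor_le algB tensor x.
  exists (D + C); first by rewrite addr_gt0.
  move=> n z; move: n; apply/sqsum_le; rewrite U_sq mulrDl EFinD; apply: leeD.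
    by rewrite lee_fin hD.
  by apply/sqsum_le => n; exact: hC.
exists U; split.
- exact: U_in.
- move=> l [x b] [y c] _ _; apply/funext => n; apply/funext => z.
  rewrite [RHS](_ : _ = (l *: V (al x z) (b ^~ z) + V (al y z) (c ^~ z)) n) //.
  rewrite -(swindle_linear _ _ p_lin) /U /=; congr (V _ _ n).
  by apply/funext => i; rewrite /al mipDr mipZr.
- move=> [x b] c [_ /= Wb] Bc; apply/funext => n; apply/funext => z.
  rewrite /U /= /al; congr (V _ _ n).
  by apply/funext => i; rewrite mip_act.
- move=> [x b] [y c] [_ /= Wb] [_ /= Wc].
  have WUb : iset (i := Cw B) (U (x, b)) by exact: U_in.
  have WUc : iset (i := Cw B) (U (y, c)) by exact: U_in.
  have [_ h1] := Cw_iipP algB closed_B WUb WUc.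
  have [_ h2] := Cw_iipP algB closed_B Wb Wc.
  apply/funext => w; apply: rdot_inj => z.
  rewrite [RHS]rdotDr h1 h2 -al_dot.
  have /(CwP algB closed_B) [_ bb] := Wb.
  have /(CwP algB closed_B) [_ bc] := Wc.
  apply: (sqdot_swindle codeK decK p_lin p_sym p_idem) => //;
    by [move=> i; exact: p_mip|exact: column_bounded_fin].
move=> y Wy; have /(CwP algB closed_B) [By [C C0 hC]] := Wy.
(* the inverse of [U] undoes the shift; [a] collects the coordinates of the
preimage along the basis of [X] *)
pose b n : H -> H := let: (i, j) := dec n in y n - (p i \o y n) + (p i \o y (code (i, j.+1))).
pose a i := p i \o y (code (i, 0%N)).
have yE z : V (a ^~ z) (b ^~ z) = y ^~ z.
  apply/funext => n; rewrite -[n]decK; case: (dec n) => i j.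
  rewrite /V swindle_code //.
  have pb j' : p i (b (code (i, j')) z) = p i (y (code (i, j'.+1)) z).
    rewrite /b codeK /= [LHS](linD (p_lin i)) (linB (p_lin i)) !p_idem.
    by rewrite subrr add0r.
  have b1 : b (code (i, j)) z - p i (b (code (i, j)) z) =
      y (code (i, j)) z - p i (y (code (i, j)) z).
    by rewrite pb /b codeK /= [X in X - _]/GRing.add /= addrK.
  rewrite b1; case: j pb b1 => [|j] pb b1; last by rewrite pb subrK.
  by rewrite /a /= subrK.
have y_sq z : sqsum (y ^~ z) = (sqsum (a ^~ z) + sqsum (b ^~ z))%E.
  rewrite -[LHS]/(sqsum (y ^~ z)) -yE.
  by apply: (sqsum_swindle codeK decK p_lin p_sym p_idem) => i; rewrite /a /= p_idem.
have yC z : (sqsum (y ^~ z) <= (C * sq z)%:E)%E by apply/sqsum_le => n; exact: hC.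
have Ba i : B (a i) by exact: (csaM algB).
have aC n z : \sum_(i < n) sq (a i z) <= C * sq z.
  move: n; apply/(sqsum_le (a ^~ z)); apply: le_trans (yC z).
  by rewrite y_sq leeDl // sqsum_ge0.
have [x [_ xa]] := riesz_fischer tensor closed_t ou Ba aC.
exists (x, b).
  split=> //=; apply/(CwP algB closed_B); split.
    move=> n; rewrite /b; case: (dec n) => i j; apply: (csaD algB); last exact: (csaM algB).
    by apply: alg_sub => //; exact: (csaM algB).
  exists C => // n z; move: n; apply/(sqsum_le (b ^~ z)); apply: le_trans (yC z).
  by rewrite y_sq leeDr // sqsum_ge0.
apply/funext => n; apply/funext => z; rewrite -[RHS](congr1 (fun f => f n) (yE z)).
rewrite /U /=; congr (V _ _ n); apply/funext => i.
by rewrite /al xa; exact: p_idem.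
Qed.
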